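(* Let $k\ge 2$ and $n\ge 1$ be integers, let $\gamma^{(1)},\ldots,\gamma^{(k)}$ be compositions of $n$, and let $p_t=\ell(\gamma^{(t)})$ be the length of $\gamma^{(t)}$ for $t\in[k]$. Then the number $c(\gamma^{(1)},\ldots,\gamma^{(k)})$ of colored factorizations of $(1,2,\ldots,n)$ of color-compositions $(\gamma^{(1)},\ldots,\gamma^{(k)})$ is $$c(\gamma^{(1)},\ldots,\gamma^{(k)})=\frac{(n!)^{k-1}\,M^{n-1}_{p_1-1,\ldots,p_k-1}}{\prod_{t=1}^k\binom{n-1}{p_t-1}}.$$
   Context: For a positive integer $m$, $[m]=\{1,\ldots,m\}$. A composition of $n$ is a finite sequence of positive integers with sum $n$; its length is the number of its parts. Given positive integers $p_1,\ldots,p_k$, a $(p_1,\ldots,p_k)$-colored factorization of the long cycle $(1,2,\ldots,n)$ is a tuple $(\pi_1,\ldots,\pi_k,\phi_1,\ldots,\phi_k)$ where $\pi_1,\ldots,\pi_k$ are permutations of $[n]$ with $\pi_1\circ\cdots\circ\pi_k=(1,2,\ldots,n)$ and, for all $t\in[k]$, $\phi_t:[n]\to[p_t]$ is a surjective map such that $\phi_t(a)=\phi_t(b)$ whenever $a,b$ are in the same cycle of $\pi_t$. It has color-compositions $(\gamma^{(1)},\ldots,\gamma^{(k)})$ (where $\gamma^{(t)}$ is a composition of $n$ of length $p_t$) if $|\phi_t^{-1}(i)|=\gamma^{(t)}_i$ for all $t\in[k]$, $i\in[p_t]$. For nonnegative integers $m,q_1,\ldots,q_k$, $M^m_{q_1,\ldots,q_k}$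 is the coefficient of $x_1^{q_1}\cdots x_k^{q_k}$ in $\left(\prod_{i=1}^k(1+x_i)-\prod_{i=1}^kx_i\right)^m$; equivalently, it is the number of $m$-tuples $(R_1,\ldots,R_m)$ of strict subsets of $[k]$ such that each $t\in[k]$ belongs to exactly $q_t$ of the subsets $R_1,\ldots,R_m$. *)

(* Defs.v *)
From mathcomp Require Import all_boot all_order all_fingroup all_algebra.
From mathcomp Require Import mpoly.

Set Implicit Arguments.
Unset Strict Implicit.
Unset Printing Implicit Defensive.

Import GRing.Theory.

Local Open Scope nat_scope.

(* The ground set [n] = {1, ..., n} is represented by 'I_n = {0, ..., n-1},
   the set of colors [p] by 'I_p, and the set of indices [k] by 'I_k. *)

Definition is_composition (n : nat) (g : seq nat) : bool :=
  all (fun a => 0 < a) g && (sumn g == n).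

(* MathComp's product of permutations is in diagrammatic order
   ((s * u) x = u (s x)), hence the swap. *)
Definition perm_comp (n : nat) (s u : 'S_n) : 'S_n := (u * s)%g.

Lemma perm_compE (n : nat) (s u : 'S_n) (a : 'I_n) :
  perm_comp s u a = s (u a).
Proof. by rewrite permM. Qed.

Definition perm_comps (k n : nat) (pi : 'I_k -> 'S_n) : 'S_n :=
  \big[@perm_comp n/1%g]_(t < k) pi t.

Definition long_cycle (n : nat) : 'S_n := perm (@ordS_inj n).

Notation colorings k n p :=
  {dffun forall t : 'I_k, {ffun 'I_n -> 'I_(p t)}}.

Definition colored_factorization (k n : nat) (p : 'I_k -> nat)
    (pi : {ffun 'I_k -> 'S_n}) (phi : colorings k n p) : bool :=
  [&& perm_comps pi == long_cycle n,
      [forall t, forall i : 'I_(p t), exists a, phi t a == i]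
    & [forall t, forall a, forall b,
        (b \in porbit (pi t) a) ==> (phi t a == phi t b)]].

(* The i-th part of g t is nth 0 (g t) i, with i ranging over 'I_(p t). *)
Definition has_color_compositions (k n : nat) (p : 'I_k -> nat)
    (g : 'I_k -> seq nat) (phi : colorings k n p) : bool :=
  [forall t, size (g t) == p t] &&
  [forall t, forall i : 'I_(p t),
     #|[set a | phi t a == i]| == nth 0 (g t) i].

Definition num_colored_factorizations (k n : nat) (g : 'I_k -> seq nat) : nat :=
  #|[set f : {ffun 'I_k -> 'S_n} * colorings k n (fun t => size (g t)) |
      colored_factorization f.1 f.2 && has_color_compositions g f.2]|.

Definition Mcoef (k m : nat) (q : 'I_k -> nat) : int :=
  (((\prod_(i < k) (1 + 'X_i) - \prod_(i < k) 'X_i) ^+ m : {mpoly int[k]})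
     @_[multinom q i | i < k])%R.

(* Main.v *)
Require Import Defs.
From mathcomp Require Import all_boot all_order all_fingroup all_algebra.
From mathcomp Require Import all_field all_character mpoly zify ring.

(* Counting colored factorizations amounts to evaluating at the long cycle c a
   convolution of class functions F_t of S_n, where F_t(s) counts the colorings
   of type gamma^(t) constant on the cycles of s.  The only irreducible
   characters that do not vanish at c are the n hook characters chi_r
   (0 <= r < n), with chi_r(c) = (-1)^r, chi_r(1) = C(n-1,r) and
   <F_t, chi_r> = C(p_t-1,r).  As convolution by a class function acts on an
   irreducible character by a scalar, the count is
     n!^(k-1) * sum_r (-1)^r C(n-1,r) prod_t C(p_t-1,r) / C(n-1,r),
   and C(p-1,r) C(n-1,p-1) = C(n-1,r) C(n-1-r,p-1-r) turns the sum into the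
   binomial expansion of (prod (1+x_i) - prod x_i)^(n-1).  The hook characters
   are the alternating sums of the exterior powers of the permutation
   representation; they are irreducible since they have norm 1, and the scalar
   products are sums of stabilizer orders over orbits, in which every pair of a
   permutation and a non-generic configuration cancels against its product by a
   transposition. *)

Set Implicit Arguments.
Unset Strict Implicit.
Unset Printing Implicit Defensive.
Import Order.TTheory GRing.Theory Num.Theory.
Local Open Scope ring_scope.

(** * Stabilizers along an orbit, and transitivity from fiber sizes *)

Lemma sum_stab_orbit (gT : finGroupType) (X : finType) (act : gT -> X -> X)
    (S : pred X) (x0 : X) :
    (forall x, act 1%g x = x) ->
    (forall a b x, act (a * b)%g x = act b (act a x)) ->
    (forall a, S (act a x0)) -> (forall x, S x -> exists a, act a x0 = x) ->
  (\sum_(x | S x) #|[set a | act a x == x]| = #|gT|)%N.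
Proof.
move=> act1 actM Sact trS.
(* If [b] carries [x0] to [x], left translation by [b] maps the stabilizer of [x] onto the set of
   elements carrying [x0] to [x]; these sets partition the group. *)
have stabE x : S x -> #|[set a | act a x == x]| = #|[set a | act a x0 == x]|.
  case/trS=> b <-; rewrite -(card_imset _ (mulgI b)); apply: eq_card => a.
  apply/imsetP/idP => [[c]|]; rewrite inE.
    by move=> /eqP cP ->; rewrite inE actM cP.
  move=> /eqP aP; exists (b^-1 * a)%g; last by rewrite mulKVg.
  by rewrite inE -actM mulKVg aP.
rewrite (eq_bigr _ stabE) -sum1_card.
rewrite [RHS](partition_big (fun a => act a x0) S) //=.
by apply: eq_bigr => x _; rewrite -sum1_card; apply: eq_bigl => a; rewrite !inE.
Qed.

(** Equal fiber sizes make the two lists of values rearrangements of each other. Encoding a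
    configuration as a map to a finite type, this supplies the transitivity required by
    [sum_stab_orbit]. *)
Lemma perm_of_fibers (n : nat) (J : finType) (f g : 'I_n -> J) :
  (forall j, #|[set x | f x == j]| = #|[set x | g x == j]|) ->
  exists s : 'S_n, forall x, g x = f (s x).
Proof.
move=> fg; pose t (h : 'I_n -> J) := [tuple h i | i < n].
have cnt h j : count_mem j (t h) = #|[set x | h x == j]|.
  rewrite /= count_map -sum1_count big_enum_cond -sum1dep_card.
  by apply: eq_bigl => x; rewrite /=. 
have /tuple_permP[s sP] : perm_eq (t g) (t f).
  by apply/allP => j _ /=; rewrite !cnt fg.
exists s => x; have /(congr1 (fun u : n.-tuple J => tnth u x)) := val_inj sP.
by rewrite !tnth_mktuple.
Qed.

(** * The sign of a permutation on an invariant subset *)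

Section SetSign.
Variable n : nat.
Implicit Types (A B : {set 'I_n}) (s u : 'S_n).

Lemma setstabP A s :
  reflect (forall x, (s x \in A) = (x \in A)) (s \in 'N(A | 'P)%g).
Proof. by apply: (iffP astabsP) => sA x; have /= := sA x; rewrite apermE. Qed.

(** This is the diagonal coefficient of [s] at the basis vector of the exterior power indexed by
    [A]. *)
Definition set_sign A s : algC :=
  if s \in 'N(A | 'P)%g then (-1) ^+ odd_perm (restr_perm A s) else 0.

Lemma set_sign_out A s : s \notin 'N(A | 'P)%g -> set_sign A s = 0.
Proof. by rewrite /set_sign => /negPf ->. Qed.

Lemma set_sign_conj A s : (set_sign A s)^* = set_sign A s.
Proof. by rewrite /set_sign; case: ifP; rewrite ?rmorph_sign ?rmorph0. Qed.

(** If [u] does not stabilize [A], both sides vanish. The asymmetric form lets a transposition be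
    split off an arbitrary permutation. *)
Lemma set_signM A s u :
  s \in 'N(A | 'P)%g -> set_sign A (s * u)%g = set_sign A s * set_sign A u.
Proof.
move=> sA; rewrite /set_sign groupMl // sA; case: ifP => uA; last by rewrite mulr0.
by rewrite morphM // odd_permM signr_addb.
Qed.

Lemma set_sign_fix A s : {in A, forall x, s x = x} ->
  s \in 'N(A | 'P)%g -> set_sign A s = 1.
Proof.
move=> fixA sA; rewrite /set_sign sA.
suff -> : restr_perm A s = 1%g by rewrite odd_perm1.
apply/permP => x; rewrite perm1; have [xA|xA] := boolP (x \in A).
  by rewrite restr_permE // fixA.
by rewrite (out_perm (restr_perm_on _ _)).
Qed.

Lemma tperm_setstab A x y : (x \in A) = (y \in A) -> tperm x y \in 'N(A | 'P)%g.
Proof. by move=> xy; apply/setstabP => z; case: tpermP => [->|->|]. Qed.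

Lemma set_sign_tperm_in A x y :
  x \in A -> y \in A -> x != y -> set_sign A (tperm x y) = -1.
Proof.
move=> xA yA xy; have tA : tperm x y \in 'N(A | 'P)%g.
  by apply: tperm_setstab; rewrite xA yA.
rewrite /set_sign tA; suff -> : restr_perm A (tperm x y) = tperm x y.
  by rewrite odd_tperm xy.
apply/permP => z; have [zA|zA] := boolP (z \in A); first by rewrite restr_permE.
rewrite (out_perm (restr_perm_on _ _)) // tpermD //.
  by apply: contraNneq zA => <-.
by apply: contraNneq zA => <-.
Qed.

Lemma set_sign_tperm_out A x y :
  x \notin A -> y \notin A -> set_sign A (tperm x y) = 1.
Proof.
move=> xA yA; apply: set_sign_fix; last first.
  by apply: tperm_setstab; rewrite (negPf xA) (negPf yA).
move=> z zA; rewrite tpermD //.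
  by apply: contraTneq zA => <-.
by apply: contraTneq zA => <-.
Qed.

Lemma setstabJ A s u :
  ((s ^ u)%g \in 'N(A | 'P)%g) = (s \in 'N(u @^-1: A | 'P)%g).
Proof.
apply/setstabP/setstabP => sA x.
  by rewrite !inE -(sA (u x)) /conjg !permM permK.
have := sA (u^-1 x)%g; rewrite !inE permKV => <-.
by rewrite /conjg !permM.
Qed.

Lemma set_signJ A s u : set_sign A (s ^ u)%g = set_sign (u @^-1: A) s.
Proof.
rewrite /set_sign setstabJ; case: ifP => // sA.
suff -> : restr_perm A (s ^ u)%g = (restr_perm (u @^-1: A) s ^ u)%g.
  by rewrite odd_permJ.
apply/permP => x; rewrite /conjg !permM.
have [xA|xA] := boolP (x \in A).
  rewrite restr_permE ?setstabJ // !permM restr_permE // inE permKV //.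
rewrite !(out_perm (restr_perm_on _ _)) ?permKV // inE permKV //.
Qed.

Lemma set_sign_repr A :
  mx_repr 'N(A | 'P)%g (fun s => (set_sign A s)%:M : 'M[algC]_1).
Proof.
split; last by move=> s u sA _; rewrite set_signM // -scalar_mxM.
by rewrite set_sign_fix ?group1 // => x _; rewrite perm1.
Qed.

Definition set_sign_cfun A := cfRepr (MxRepresentation (set_sign_repr A)).

Lemma set_sign_cfunE A : set_sign_cfun A =1 set_sign A.
Proof.
move=> s; rewrite cfunE /= mxtrace_scalar mulr1n.
by rewrite /set_sign; case: (s \in _); rewrite ?mulr1n ?mulr0n.
Qed.

Lemma card_eq_imset A B : #|A| = #|B| -> exists u : 'S_n, B = u @^-1: A.
Proof.
move=> AB; have [|s sP] := @perm_of_fibers n _ (mem A) (mem B).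
  have cT (C : {set 'I_n}) : [set x | (mem C x) == true] = C.
    by apply/setP => x; rewrite !inE eqb_id.
  have cF (C : {set 'I_n}) : [set x | (mem C x) == false] = ~: C.
    by apply/setP => x; rewrite !inE eqbF_neg.
  case; first by rewrite !cT.
  by rewrite !cF; apply/eqP; rewrite -(eqn_add2l #|A|) cardsC AB cardsC.
by exists s; apply/setP => x; rewrite inE; have := sP x.
Qed.

(** Induction averages over the conjugates of [s], hence over the sets [u @^-1: A]; each set of the
    size of [A] arises as often as the stabilizer of [A] has elements. *)
Lemma Ind_set_sign A s :
  'Ind[[set: 'S_n]] (set_sign_cfun A) s = \sum_(B : {set 'I_n} | #|B| == #|A|) set_sign B s.
Proof.
rewrite cfIndE ?subsetT //.
apply: (canLR (mulKf _)); first by rewrite pnatr_eq0 -lt0n cardG_gt0.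
rewrite (partition_big (fun u : 'S_n => u @^-1: A) (fun B : {set 'I_n} => #|B| == #|A|)) /=; last first.
  by move=> u _; rewrite card_preimset //; apply: perm_inj.
rewrite mulr_sumr; apply: eq_bigr => B /eqP AB.
have [u0 uB] := card_eq_imset (esym AB).
rewrite (eq_bigr (fun _ => set_sign B s)); last first.
  by move=> u /andP[_ /eqP <-]; rewrite set_sign_cfunE set_signJ.
rewrite sumr_const mulr_natl; congr (_ *+ _).
rewrite -[RHS](card_imset _ (mulgI u0)); apply: eq_card => u.
apply/idP/imsetP => [/andP[_ /eqP uA]|[w /setstabP wA ->]].
  exists (u0^-1 * u)%g; last by rewrite mulKVg.
  apply/setstabP => x; have := congr1 (fun C : {set _} => (u0^-1)%g x \in C) uA.
  by rewrite /= uB !inE permKV permM.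
apply/andP; split; first exact: in_setT.
by apply/eqP; rewrite uB; apply/setP => x; rewrite !inE permM wA.
Qed.
End SetSign.

Lemma sum_perm_eq0 (n : nat) (u : 'S_n) (f : 'S_n -> algC) :
  (forall s, f (u * s)%g = - f s) -> \sum_s f s = 0.
Proof.
move=> fu; apply/eqP; rewrite -eqNr; apply/eqP.
by rewrite [RHS](reindex_inj (mulgI u)) -sumrN; apply: eq_bigr.
Qed.

(** * Pairs of subsets and the sums of their signs *)

Section SetPairs.
Variable n : nat.
Implicit Types (A B : {set 'I_n}) (s u : 'S_n) (X : {set 'I_n} * {set 'I_n}).

(** A transposition of two points of [A :\: B] has sign -1 on [A] and 1 on [B], so translating by it
    negates the summand. *)
Lemma sum_set_sign_pair0 A B : (1 < #|A :\: B|)%N ->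
  \sum_s set_sign A s * set_sign B s = 0.
Proof.
move=> /card_gt1P[x [y [/setDP[xA xB] /setDP[yA yB] xy]]].
apply: (@sum_perm_eq0 _ (tperm x y)) => s; rewrite !set_signM.
- by rewrite set_sign_tperm_in // set_sign_tperm_out // mul1r mulN1r mulNr.
- by apply: tperm_setstab; rewrite (negPf xB) (negPf yB).
- by apply: tperm_setstab; rewrite xA yA.
Qed.

Lemma setstab_fix A s : (#|A| <= 1)%N -> s \in 'N(A | 'P)%g ->
  {in A, forall x, s x = x}.
Proof.
move=> /card_le1_eqP A1 /setstabP sA x xA.
by apply: A1; rewrite ?sA.
Qed.

(** Both difference sets are stable and have at most one point, so [s] fixes them pointwise and
    restricts to the same permutation on [A] and on [B]. *)
Lemma set_sign_pair1 A B s : (#|A :\: B| <= 1)%N -> (#|B :\: A| <= 1)%N ->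
  s \in 'N(A | 'P)%g -> s \in 'N(B | 'P)%g -> set_sign A s * set_sign B s = 1.
Proof.
move=> AB BA sA sB; have /setstabP sAP := sA; have /setstabP sBP := sB.
have fixAB : {in A :\: B, forall x, s x = x}.
  by apply: setstab_fix => //; apply/setstabP => x; rewrite !inE sAP sBP.
have fixBA : {in B :\: A, forall x, s x = x}.
  by apply: setstab_fix => //; apply/setstabP => x; rewrite !inE sAP sBP.
suff eqAB : restr_perm A s = restr_perm B s.
  by rewrite /set_sign sA sB eqAB -signr_addb addbb.
apply/permP => x; have [xA|xA] := boolP (x \in A); have [xB|xB] := boolP (x \in B).
- by rewrite !restr_permE.
- rewrite restr_permE // (out_perm (restr_perm_on _ _)) //.
  by apply: fixAB; rewrite inE xA xB.
- rewrite (restr_permE sB) // (out_perm (restr_perm_on _ _)) //.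
  by rewrite fixBA // inE xA xB.
- by rewrite !(out_perm (restr_perm_on _ _)).
Qed.

Lemma sum_set_sign_pair A B :
  \sum_s set_sign A s * set_sign B s =
  (((#|A :\: B| <= 1) && (#|B :\: A| <= 1))
     * #|'N(A | 'P)%g :&: 'N(B | 'P)%g|)%N%:R.
Proof.
have [AB|AB] := leqP #|A :\: B| 1; last by rewrite mul0n sum_set_sign_pair0.
have [BA|BA] := leqP #|B :\: A| 1; last first.
  by rewrite mul0n; under eq_bigr do rewrite mulrC; rewrite sum_set_sign_pair0.
rewrite mul1n -sumr_const [RHS]big_mkcond /=; apply: eq_bigr => s _.
rewrite inE; case: ifP => [/andP[sA sB]|]; first exact: set_sign_pair1.
move/negbT; rewrite negb_and => /orP[sA|sB].
  by rewrite set_sign_out // mul0r.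
by rewrite mulrC set_sign_out // mul0r.
Qed.

Lemma card_ord_interval a b : (b <= n)%N ->
  #|[set i : 'I_n | (a <= i < b)%N]| = (b - a)%N.
Proof.
move=> bn; transitivity (\sum_(a <= i < b) 1)%N; last by rewrite sum_nat_const_nat muln1.
rewrite -sum1dep_card big_geq_mkord.
by rewrite (big_ord_widen_cond n (fun i => true && (a <= i)%N) (fun=> 1%N)).
Qed.

(** Pairs with these three cardinalities form a single orbit; the inequalities ensure that one
    exists. *)
Lemma sum_stab_pair r t d : (d <= r)%N -> (d <= t)%N -> (r + t <= n + d)%N ->
  (\sum_(X : {set 'I_n} * {set 'I_n} | [&& #|X.1| == r, #|X.2| == t & #|X.1 :&: X.2| == d])
     #|'N(X.1 | 'P)%g :&: 'N(X.2 | 'P)%g| = n`!)%N.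
Proof.
move=> dr ds rsd.
have [X0 X0P] : exists X : {set 'I_n} * {set 'I_n}, [&& #|X.1| == r, #|X.2| == t & #|X.1 :&: X.2| == d].
  (* Two intervals overlapping in exactly [d] points. *)
  exists ([set i : 'I_n | (0 <= i < r)%N], [set i : 'I_n | (r - d <= i < r - d + t)%N]).
  have -> : [set i : 'I_n | (0 <= i < r)%N] :&: [set i : 'I_n | (r - d <= i < r - d + t)%N]
          = [set i : 'I_n | (r - d <= i < r)%N].
    by apply/setP => i; rewrite !inE; lia.
  by rewrite !card_ord_interval /=; lia.
pose act (u : 'S_n) X := (u^-1%g @^-1: X.1, u^-1%g @^-1: X.2).
have := @sum_stab_orbit _ _ act
  (fun X : {set 'I_n} * {set 'I_n} => [&& #|X.1| == r, #|X.2| == t & #|X.1 :&: X.2| == d]) X0.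
rewrite card_Sn => <-.
- apply: eq_bigr => -[A B] _; apply: eq_card => u.
  have stabE (C : {set 'I_n}) : (u^-1%g @^-1: C == C) = (u \in 'N(C | 'P)%g).
    rewrite -groupV; apply/eqP/setstabP => [uC x|uC]; first by rewrite -{2}uC inE.
    by apply/setP => x; rewrite !inE.
  by rewrite in_setI [RHS]inE xpair_eqE /= !stabE.
- by case=> A B; rewrite /act invg1; congr (_, _); apply/setP => x; rewrite inE perm1.
- move=> a b [A B]; rewrite /act invMg.
  by congr (_, _); apply/setP => x; rewrite !inE permM.
- move=> a; rewrite /act /= -preimsetI !card_preimset //; exact: perm_inj.
- move=> [A B] /=; case: X0 X0P => [A0 B0] /= /and3P[/eqP Ar /eqP Bs /eqP ABd].
  move=> /and3P[/eqP Ar' /eqP Bs' /eqP ABd'].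
  (* The fibers of the pair of membership tests are the four regions of the Venn diagram, whose
     sizes are determined by [r], [t] and [d]. *)
  have cfib (C D : {set 'I_n}) j : #|[set x | (x \in C, x \in D) == j]| =
     match j with (true, true) => #|C :&: D| | (true, false) => #|C :\: D|
     | (false, true) => #|D :\: C| | (false, false) => (n - #|C :|: D|)%N end.
    have -> : (n - #|C :|: D| = #|~: (C :|: D)|)%N.
      by have := cardsC (C :|: D); rewrite card_ord; lia.
    by case: j => [[] []]; apply: eq_card => x;
      rewrite !inE xpair_eqE ?eqb_id ?eqbF_neg ?negb_or // andbC.
  have [j|u uP] := @perm_of_fibers n _ (fun x => (x \in A0, x \in B0))
     (fun x => (x \in A, x \in B)).
    rewrite !cfib !cardsD !cardsU ![B :&: A]setIC ![B0 :&: A0]setIC.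
    by rewrite Ar Ar' Bs Bs' ABd ABd'.
  exists u^-1%g; rewrite /act invgK /=; congr (_, _); apply/setP => x; rewrite !inE;
   by have [] := uP x.
Qed.

End SetPairs.

(** * Exterior powers and hook characters *)

Section Hooks.
Variable n : nat.
Hypothesis n_gt0 : (0 < n)%N.
Implicit Types (A B : {set 'I_n}) (s u : 'S_n).

(* The character of the r-th exterior power of the permutation representation. *)
Definition wedge r : 'CF([set: 'S_n]) :=
  'Ind (set_sign_cfun [set i : 'I_n | (0 <= i < r)%N]).

Lemma wedgeE r s : (r <= n)%N ->
  wedge r s = \sum_(A : {set 'I_n} | #|A| == r) set_sign A s.
Proof. by move=> rn; rewrite Ind_set_sign card_ord_interval ?subn0. Qed.

Lemma wedge_vchar r : wedge r \in 'Z[irr [set: 'S_n]]%g.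
Proof. exact/char_vchar/cfInd_char/cfRepr_char. Qed.

Lemma wedge1 r : (r <= n)%N -> wedge r 1%g = 'C(n, r)%:R.
Proof.
move=> rn; rewrite wedgeE // (eq_bigr (fun=> 1)) => [|A _]; last first.
  by rewrite set_sign_fix ?group1 // => x _; rewrite perm1.
by rewrite sumr_const -[in 'C(n, r)](card_ord n) -card_draws cardsE.
Qed.

(** By [sum_set_sign_pair] only pairs whose two differences have at most one point contribute. They
    form one orbit for each intersection size [d], each contributing [n!], and the right side counts
    the admissible [d]. *)
Lemma cfdot_wedge r t : (r < n)%N -> (t < n)%N ->
  '[wedge r, wedge t] =
  ((r == t) + ((r == t) && (0 < r)) + (r == t.+1) + (t == r.+1))%N%:R.
Proof.
move=> rn tn; rewrite cfdotE cardsT card_Sn.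
apply: (canLR (mulKf _)); first by rewrite pnatr_eq0 -lt0n fact_gt0.
under eq_bigr => s _.
  rewrite !wedgeE ?(ltnW rn) ?(ltnW tn) // rmorph_sum /=.
  rewrite big_distrlr /=.
  under eq_bigr => A _ do under eq_bigr => B _ do rewrite set_sign_conj.
  over.
rewrite (eq_bigl xpredT) => [|s]; last by rewrite inE.
rewrite exchange_big /=; under eq_bigr => A _.
  rewrite exchange_big /=.
  under eq_bigr => B _ do rewrite sum_set_sign_pair.
  over.
rewrite pair_big_dep /= -natr_sum -natrM; congr _%:R.
pose S d : bool := [&& (d <= r), (d <= t), (r <= d.+1) & (t <= d.+1)]%N.
rewrite (partition_big (fun X : {set 'I_n} * {set 'I_n} => inord #|X.1 :&: X.2| : 'I_n.+1) xpredT) //=.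
transitivity (\sum_(d < n.+1) n`! * S d)%N.
  apply: eq_bigr => d _.
  have inordE (X : {set 'I_n} * {set 'I_n}) : (inord #|X.1 :&: X.2| == d) = (#|X.1 :&: X.2| == d).
    rewrite -val_eqE /= inordK // ltnS -[n in (_ <= n)%N]card_ord; exact: max_card.
  under eq_bigl => X do rewrite inordE -andbA.
  under eq_bigr => X /and3P[/eqP Xr /eqP Xt /eqP Xd].
    rewrite !cardsD [X.2 :&: X.1]setIC Xr Xt Xd.
    over.
  rewrite -big_distrr /=.
  have [dr|dr] := leqP d r; last first.
    rewrite big1 ?muln0 /S.
      by rewrite leqNgt dr /= muln0.
    move=> X /and3P[/eqP Xr _ /eqP Xd].
    by have := subset_leq_card (subsetIl X.1 X.2); rewrite Xr Xd leqNgt dr.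
  have [dt|dt] := leqP d t; last first.
    rewrite big1 ?muln0 /S.
      by rewrite dr leqNgt dt /= muln0.
    move=> X /and3P[_ /eqP Xt /eqP Xd].
    by have := subset_leq_card (subsetIr X.1 X.2); rewrite Xt Xd leqNgt dt.
  case Sd : (S d); last first.
    move: Sd; rewrite /S dr dt /= muln0 !leq_subLR !addn1 => ->.
    by rewrite mul0n.
  have [rd td] : (r <= d.+1)%N /\ (t <= d.+1)%N by case/and4P: Sd.
  (* The remaining inequality [r + t <= n + d] follows from [r <= d.+1] and [t < n]. *)
  rewrite sum_stab_pair //; last by lia.
  by rewrite !leq_subLR !addn1 rd td mul1n muln1.
rewrite -big_distrr /=; congr (_ * _)%N.
have sum_eq e c : (e < n.+1)%N -> (\sum_(d < n.+1) (d == e :> nat) * c = c)%N.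
  move=> en; rewrite (bigD1 (Ordinal en)) //= eqxx mul1n big1 ?addn0 // => d.
  by rewrite -val_eqE /= => /negPf ->.
(* [S d] forces [d] to be [r] or [r.-1]; [c1] and [c2] are its values there, with [0 < r] preventing
   a double count when [r] and [r.-1] are both 0. *)
pose c1 : nat := (r <= t <= r.+1)%N; pose c2 : nat := [&& (0 < r), (r.-1 <= t) & (t <= r)]%N.
rewrite (eq_bigr (fun d : 'I_n.+1 => (d == r :> nat) * c1 + (d == r.-1 :> nat) * c2)%N).
  by rewrite big_split /= !sum_eq /c1 /c2; lia.
move=> d _; move: (nat_of_ord d) => e; rewrite /S /c1 /c2.
by case: (e =P r) => er; case: (e =P r.-1) => er'; rewrite ?mul1n ?mul0n; lia.
Qed.

(* The irreducible character of the hook partition (n - r, 1^r). *)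
Fixpoint hook r : 'CF([set: 'S_n]) :=
  if r is r'.+1 then wedge r - hook r' else wedge 0.

Lemma hook_vchar r : hook r \in 'Z[irr [set: 'S_n]]%g.
Proof. by elim: r => [|r IHr]; rewrite /= ?rpredB // wedge_vchar. Qed.

Lemma hook1 r : (r < n)%N -> hook r 1%g = 'C(n - 1, r)%:R.
Proof.
elim: r => [|r IHr] rn /=; first by rewrite wedge1 // !bin0.
rewrite !cfunE wedge1 ?IHr 1?ltnW // -[n in 'C(n, _)](subnK n_gt0) addn1 binS.
by rewrite natrD addrK.
Qed.

(** Reflects the decomposition of [wedge r] as [hook r + hook r.-1] for positive [r]. *)
Lemma cfdot_wedge_hook r t : (r < n)%N -> (t < n)%N ->
  '[wedge r, hook t] = ((r == t) + (r == t.+1))%N%:R.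
Proof.
elim: t => [|t IHt] rn tn /=.
  by rewrite cfdot_wedge //; congr _%:R; lia.
rewrite cfdotBr IHt ?cfdot_wedge ?(ltnW tn) //.
apply: (canLR (addrK _)); rewrite -natrD; congr _%:R; lia.
Qed.

Lemma cfdot_hook r t : (r < n)%N -> (t < n)%N -> '[hook r, hook t] = (r == t)%:R.
Proof.
elim: r => [|r IHr] rn tn /=.
  by rewrite cfdot_wedge_hook // addn0.
rewrite cfdotBl IHr ?cfdot_wedge_hook ?(ltnW rn) //.
by apply: (canLR (addrK _)); rewrite -natrD; congr _%:R; lia.
Qed.

(** A virtual character of norm 1 is an irreducible character up to sign; the value at the identity,
    a binomial coefficient, excludes the minus sign. *)
Lemma hook_irr r : (r < n)%N -> exists i, hook r = 'chi_i.
Proof.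
move=> rn; have n1 : '[hook r] = 1 by rewrite cfdot_hook // eqxx.
have [b [i hi]] := vchar_norm1P (hook_vchar r) n1.
exists i; case: b hi => hi; last by rewrite hi scale1r.
have := hook1 rn; rewrite hi cfunE /= expr1 mulN1r => h.
by have := irr1_gt0 i; rewrite -oppr_lt0 h ltrn0.
Qed.

Lemma hook_conj r s : (r < n)%N -> (hook r s)^* = hook r s.
Proof.
have wR t : (t < n)%N -> (wedge t s)^* = wedge t s.
  move=> tn; rewrite wedgeE 1?ltnW // rmorph_sum /=.
  by apply: eq_bigr => A _; rewrite set_sign_conj.
elim: r => [|r IHr] rn /=; first exact: wR.
by rewrite !cfunE rmorphB /= wR // IHr // ltnW.
Qed.
End Hooks.

(** * Hook characters at the long cycle and the indicator of its class *)

Section LongCycle.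
Variable n : nat.
Hypothesis n_gt0 : (0 < n)%N.
Implicit Types (A B : {set 'I_n}) (s u : 'S_n).
Let c := long_cycle n.
Let x0 : 'I_n := Ordinal n_gt0.

Lemma long_cycleX i : (i < n)%N -> (c ^+ i)%g x0 = i :> nat.
Proof.
elim: i => [|i IHi] ltin; first by rewrite expg0 perm1.
by rewrite expgSr permM permE /= IHi ?modn_small // ltnW.
Qed.

Lemma long_cycle_transitive (x : 'I_n) : x = (c ^+ x)%g x0.
Proof. by apply: ord_inj; rewrite long_cycleX. Qed.

(** Powers of [c] carry [x0] to every point, so a permutation commuting with [c] is determined by
    the image of [x0]. *)
Lemma card_cent_long_cycle : (#|'C_[set: 'S_n][c]%g| <= n)%N.
Proof.
rewrite -[X in (_ <= X)%N]card_ord -cardsT.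
rewrite -(card_in_imset (f := fun s : 'S_n => s x0)); first exact/subset_leq_card/subsetT.
move=> s u /setIP[_ /cent1P sc] /setIP[_ /cent1P uc] su.
apply/permP => x; rewrite (long_cycle_transitive x) -!permM.
rewrite -(commuteX x sc) -(commuteX x uc).
by rewrite !permM su.
Qed.

Lemma long_cycle_stab A : c \in 'N(A | 'P)%g -> (A == set0) || (A == setT).
Proof.
move=> cA; have cE x : (x \in A) = (x0 \in A).
  rewrite {1}(long_cycle_transitive x).
  by have /setstabP -> : (c ^+ x)%g \in 'N(A | 'P)%g by rewrite groupX.
by case: (boolP (x0 \in A)) cE => _ cE; apply/orP; [right|left];
  apply/eqP/setP => x; rewrite cE !inE.
Qed.

(** Only the empty and the full set are stable under [c], and [r < n] excludes the full one. *)
Lemma wedge_long_cycle r : (r < n)%N -> wedge n r c = (r == 0)%:R.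
Proof.
move=> rn; rewrite wedgeE 1?ltnW //.
case: r rn => [|r] rn.
  rewrite (eq_bigl (pred1 set0)) => [|A]; last by rewrite /= cards_eq0.
  rewrite big_pred1_eq set_sign_fix // => [x|]; first by rewrite inE.
  by apply/setstabP => x; rewrite !inE.
rewrite big1 // => A /eqP Ar; rewrite set_sign_out //.
apply: contraL rn => /long_cycle_stab/orP[/eqP A0|/eqP A1].
  by rewrite A0 cards0 in Ar.
by rewrite -Ar A1 cardsT card_ord ltnn.
Qed.

Lemma hook_long_cycle r : (r < n)%N -> hook n r c = (-1) ^+ r.
Proof.
elim: r => [|r IHr] rn /=; first by rewrite wedge_long_cycle.
by rewrite !cfunE wedge_long_cycle // IHr 1?ltnW // sub0r exprS mulN1r.
Qed.

(** The coefficients are the values of the hooks at [c], as in column orthogonality: this turns out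
    to be [n] times the indicator of the class of [c]. *)
Definition hook_altsum : 'CF([set: 'S_n]) := \sum_(r < n) (-1) ^+ r *: hook n r.

Lemma hook_altsum_conj s : (hook_altsum s)^* = hook_altsum s.
Proof.
rewrite /hook_altsum sum_cfunE rmorph_sum; apply: eq_bigr => r _ /=.
by rewrite !cfunE rmorphM /= rmorph_sign hook_conj.
Qed.

Lemma hook_altsum_long_cycle : hook_altsum c = n%:R.
Proof.
rewrite sum_cfunE (eq_bigr (fun=> 1)) => [|r _].
  by rewrite sumr_const card_ord.
by rewrite cfunE hook_long_cycle // -exprMn mulrNN mulr1 expr1n.
Qed.

Lemma cfnorm_hook_altsum : '[hook_altsum] = n%:R.
Proof.
rewrite cfdot_suml (eq_bigr (fun=> 1)) => [|r _].
  by rewrite sumr_const card_ord.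
rewrite cfdot_sumr (bigD1 r) //= big1 ?addr0 => [|t tr].
  by rewrite cfdotZl cfdotZr cfdot_hook // eqxx mulr1 rmorph_sign -exprMn mulrNN mulr1 expr1n.
by rewrite cfdotZl cfdotZr cfdot_hook // -val_eqE eq_sym in tr *; rewrite (negPf tr) !mulr0.
Qed.

(* At most n permutations commute with the long cycle, so its class alone
   accounts for the whole norm of [hook_altsum]. *)
Lemma hook_altsumE :
  (#|(c ^: [set: 'S_n])%g| * n)%N = n`! /\
  forall s, s \notin (c ^: [set: 'S_n])%g -> hook_altsum s = 0.
Proof.
set C := (c ^: _)%g.
have Cclass : (n`! <= #|C| * n)%N.
  have := Lagrange (subsetIl [set: 'S_n] 'C[c]%g).
  rewrite index_cent1 cardsT card_Sn mulnC => <-.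
  by rewrite leq_mul2l card_cent_long_cycle orbT.
have inC s : s \in C -> hook_altsum s = n%:R.
  by case/imsetP => u _ ->; rewrite cfunJ ?in_setT // hook_altsum_long_cycle.
have: \sum_s hook_altsum s ^+ 2 = (n`! * n)%:R.
  have := cfnorm_hook_altsum; rewrite cfdotE cardsT card_Sn => /(canRL (mulVKf _)) h.
  rewrite natrM -h ?pnatr_eq0 -?lt0n ?fact_gt0 //.
  rewrite [RHS](eq_bigl xpredT) => [|s]; last by rewrite inE.
  by apply: eq_bigr => s _; rewrite hook_altsum_conj expr2.
rewrite (bigID (mem C)) /=.
rewrite (eq_bigr (fun=> (n ^ 2)%:R)) => [|s /inC ->]; last by rewrite natrX.
rewrite sumr_const -mulrnA => sumE.
have ge0 s : 0 <= hook_altsum s ^+ 2.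
  by rewrite expr2 -{2}hook_altsum_conj mul_conjC_ge0.
have cardC : (#|C| * n)%N = n`!.
  apply/eqP; rewrite eqn_leq Cclass andbT -(leq_pmul2r n_gt0) -(ler_nat algC).
  by rewrite -sumE -mulnA mulnC lerDl sumr_ge0.
split=> // s sC; move: sumE.
rewrite -cardC [(n ^ 2 * _)%N]mulnC -mulnA => /(canRL (addKr _)).
rewrite addNr => /eqP; rewrite psumr_eq0 // => /allP /(_ s).
by rewrite mem_index_enum sC sqrf_eq0 => /(_ isT) /eqP.
Qed.

(** Evaluation of a class function at the long cycle thus becomes a combination of its pairings with
    the hooks. *)
Lemma sum_hook_altsum (N : 'S_n -> algC) : (forall s u, N (s ^ u)%g = N s) ->
  \sum_s N s * hook_altsum s = n`!%:R * N c.
Proof.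
move=> NJ; have [cardC out] := hook_altsumE.
rewrite (bigID (mem (c ^: [set: 'S_n])%g)) /= [X in _ + X]big1 ?addr0 => [|s sC]; last first.
  by rewrite out ?mulr0.
rewrite (eq_bigr (fun=> N c * n%:R)) => [|s /imsetP[u _ ->]]; last first.
  by rewrite NJ cfunJ ?in_setT // hook_altsum_long_cycle.
by rewrite sumr_const -cardC -mulrnAr -mulrnA mulrC mulnC.
Qed.
End LongCycle.

(** * Scalar products of coloring counts with hook characters *)

Section Colorings.
Variables (n : nat) (g : seq nat).
Hypotheses (n_gt0 : (0 < n)%N) (g_comp : is_composition n g).
Let p := size g.
Local Notation coloring := {ffun 'I_n -> 'I_p}.
Implicit Types (phi : coloring) (A B : {set 'I_n}) (K : {set 'I_p}) (s u : 'S_n).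

Definition has_type phi : bool :=
  [forall i : 'I_p, #|[set a | phi a == i]| == nth 0 g i]%N.
Definition stabilizes phi s : bool := [forall a, phi (s a) == phi a].
Definition num_colorings s : nat := #|[set phi | has_type phi && stabilizes phi s]|.

Lemma stabilizesP phi s : reflect (forall a, phi (s a) = phi a) (stabilizes phi s).
Proof. exact: 'forall_eqP. Qed.

Lemma stabilizes_porbit phi s :
  [forall a, forall b, (b \in porbit s a) ==> (phi a == phi b)] = stabilizes phi s.
Proof.
apply/'forall_forallP/stabilizesP => [sP a|sP a b].
  by have := sP a (s a); rewrite -{1}[s]expg1 mem_porbit => /eqP.
apply/implyP => /porbitP[i ->]; apply/eqP.
by elim: i => [|i IHi]; rewrite ?expg0 ?perm1 // expgSr permM sP.
Qed.

Lemma has_type_comp phi s : has_type [ffun x => phi (s x)] = has_type phi.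
Proof.
apply: eq_forallb => i; congr (_ == _).
rewrite -[RHS](card_preimset _ (@perm_inj _ s)).
by apply: eq_card => x; rewrite !inE ffunE.
Qed.

Lemma num_coloringsJ s u : num_colorings (s ^ u)%g = num_colorings s.
Proof.
pose h phi : coloring := [ffun x => phi (u x)].
have h_inj : injective h.
  move=> phi psi /ffunP e; apply/ffunP => x.
  by have := e (u^-1 x)%g; rewrite !ffunE permKV.
rewrite /num_colorings -[RHS](card_preimset _ h_inj); apply: eq_card => phi.
rewrite !inE has_type_comp; congr (_ && _).
apply/stabilizesP/stabilizesP => sP x.
  by rewrite !ffunE; have := sP (u x); rewrite /conjg !permM permK.
have := sP (u^-1 x)%g; rewrite !ffunE permKV => <-.
by rewrite /conjg !permM.
Qed.

Definition coloring_cfun : 'CF([set: 'S_n]).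
Proof.
refine (Cfun 0 (intro_class_fun (f := fun s => (num_colorings s)%:R) _ _)).
  by move=> s u _ _; rewrite num_coloringsJ.
by move=> s /negP[]; apply: mem_gen; apply: in_setT.
Defined.

Lemma coloring_cfunE s : coloring_cfun s = (num_colorings s)%:R.
Proof. by rewrite cfunE. Qed.

(** If two points of [A] share a color, their transposition preserves [phi] and flips the sign on
    [A], so everything cancels. Otherwise a permutation stabilizing both [phi] and [A] fixes [A]
    pointwise and has sign 1. *)
Lemma sum_set_sign_stabilizes phi A :
  \sum_s (stabilizes phi s)%:R * set_sign A s =
  ((#|phi @: A| == #|A|) * #|[set s | stabilizes phi s && (s \in 'N(A | 'P)%g)]|)%N%:R.
Proof.
have [/eqP/imset_injP A_inj|] := eqVneq.
  rewrite mul1n -sum1dep_card natr_sum [RHS]big_mkcond; apply: eq_bigr => s _ /=.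
  case: (stabilizesP phi s) => [sP|]; last by rewrite mul0r.
  rewrite mul1r /=; case: ifPn => [sA|]; last by exact: set_sign_out.
  apply: set_sign_fix => // x xA; apply: A_inj => //.
  by move/setstabP: (sA) => ->.
move=> /eqP/eqP/imset_injP A_ninj; rewrite mul0n.
have /existsP[x /existsP[y /and4P[xA yA xy /eqP pxy]]] :
    [exists x, exists y, [&& x \in A, y \in A, x != y & phi x == phi y]].
  apply: contra_notT A_ninj => /existsPn ninj x y xA yA pxy; apply/eqP.
  by apply: contraT => xy; have /existsPn/(_ y) := ninj x; rewrite xA yA xy pxy eqxx.
have phit z : phi (tperm x y z) = phi z by case: tpermP => [->|->|].
apply: (@sum_perm_eq0 _ (tperm x y)) => s.
rewrite set_signM ?tperm_setstab ?xA ?yA // set_sign_tperm_in // mulN1r mulrN.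
congr (- (_%:R * _)); congr (nat_of_bool _).
apply/stabilizesP/stabilizesP => sP a.
  by have := sP (tperm x y a); rewrite permM tpermK phit.
by rewrite permM sP phit.
Qed.

Lemma exists_has_type : exists phi, has_type phi.
Proof.
(* The word repeating each color [i] as often as the part [nth 0 g i] says has length [n] and serves
   as the coloring. *)
pose l := flatten [seq nseq (nth 0%N g i) i | i : 'I_p].
have cnt a : count a l = (\sum_(i < p | a i) nth 0 g i)%N.
  rewrite count_flatten -map_comp sumnE big_map big_enum /= [RHS]big_mkcond /=.
  apply: eq_bigr => i _; rewrite count_nseq; by case: (a i); rewrite ?mul1n.
have sz : size l == n.
  rewrite -count_predT cnt; case/andP: g_comp => _ /eqP <-.
  by rewrite sumnE (big_nth 0%N) big_mkord.
exists [ffun x => tnth (Tuple sz) x]; apply/forallP => i; apply/eqP.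
transitivity (count_mem i (map (tnth (Tuple sz)) (enum 'I_n))); last first.
  by rewrite map_tnth_enum /= cnt big_pred1_eq.
rewrite count_map -sum1_count big_enum_cond -sum1dep_card.
by apply: eq_bigl => x; rewrite ffunE.
Qed.

(** The pairs of a coloring and a set meeting each color of [K] exactly once, and no other color,
    form a single orbit. *)
Lemma sum_stab_coloring K :
  (\sum_(X : coloring * {set 'I_n} |
      [&& has_type X.1, #|X.1 @: X.2| == #|X.2| & X.1 @: X.2 == K])
     #|[set s | stabilizes X.1 s && (s \in 'N(X.2 | 'P)%g)]| = n`!)%N.
Proof.
have [X0 X0P] : exists X : coloring * {set 'I_n},
    [&& has_type X.1, #|X.1 @: X.2| == #|X.2| & X.1 @: X.2 == K].
  have [phi phiT] := exists_has_type.
  (* Since parts are positive, every color has a representative; those of the colors in [K] form the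
     required set. *)
  have [|rep repP] := @fin_all_exists _ _ (fun i x => phi x = i).
    move=> i; move/forallP/(_ i)/eqP: (phiT) => ci.
    have: (0 < #|[set a | phi a == i]|)%N.
      by rewrite ci; case/andP: g_comp => /all_nthP gP _; apply: gP.
    by case/card_gt0P => x; rewrite inE => /eqP; exists x.
  exists (phi, rep @: K) => /=.
  have -> : phi @: (rep @: K) = K.
    rewrite -imset_comp -[RHS]imset_id; apply: eq_imset => i; exact: repP.
  have rep_inj : injective rep by apply: (can_inj (g := phi)).
  by rewrite phiT card_imset // !eqxx.
pose act (u : 'S_n) (X : coloring * {set 'I_n}) : coloring * {set 'I_n} :=
  ([ffun x => X.1 (u^-1%g x)], u^-1%g @^-1: X.2).
have imE u (X : coloring * {set 'I_n}) : (act u X).1 @: (act u X).2 = X.1 @: X.2.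
  apply/setP => i; apply/imsetP/imsetP => -[x xX ->].
    by exists (u^-1%g x); rewrite ?ffunE //; rewrite inE in xX.
  by exists (u x); rewrite ?inE ?ffunE permK.
have := @sum_stab_orbit _ _ act
  (fun X => [&& has_type X.1, #|X.1 @: X.2| == #|X.2| & X.1 @: X.2 == K]) X0.
rewrite card_Sn => <-.
- apply: eq_bigr => -[phi A] _; apply: eq_card => u.
  rewrite [LHS]in_set [RHS]in_set xpair_eqE; congr (_ && _).
    rewrite /=; apply/stabilizesP/eqP => [uP|uP x].
      by apply/ffunP => x; rewrite ffunE -[in RHS](permKV u x) uP.
    by rewrite -{1}uP ffunE permK.
  rewrite /= -groupV; apply/setstabP/eqP => [uA|uA x]; last by rewrite -{2}uA inE.
  by apply/setP => x; rewrite inE uA.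
- case=> phi A; rewrite /act invg1; congr (_, _).
    by apply/ffunP => x; rewrite ffunE perm1.
  by apply/setP => x; rewrite inE perm1.
- move=> a b [phi A]; rewrite /act invMg; congr (_, _).
    by apply/ffunP => x; rewrite !ffunE permM.
  by apply/setP => x; rewrite !inE permM.
- move=> a; rewrite imE /act /= has_type_comp card_preimset //; exact: perm_inj.
- move=> [phi A]; case: X0 X0P => [phi0 A0] /=.
  (* Among the points of color [i], exactly one lies in the set if [i \in K], and none otherwise; so
     the fiber sizes depend only on [g] and [K]. *)
  have cfib (psi : coloring) (B : {set 'I_n}) i b :
      has_type psi -> #|psi @: B| == #|B| -> psi @: B == K ->
      #|[set x | (psi x, x \in B) == (i, b)]| =
        (if b then i \in K : nat else nth 0 g i - (i \in K))%N.
    move=> /forallP/(_ i)/eqP <- /imset_injP psi_inj /eqP <-.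
    have BE : #|[set x in B | psi x == i]| = (i \in psi @: B).
      have [/imsetP[x xB ->]|iB] := boolP (i \in psi @: B).
        apply: (etrans _ (cards1 x)); apply: eq_card => y; rewrite !inE.
        apply/andP/eqP => [[yB /eqP]|->]; last by rewrite xB eqxx.
        exact: psi_inj.
      apply: eq_card0 => x; rewrite inE; apply: contraNF iB => /andP[xB /eqP <-].
      exact: imset_f.
    rewrite -BE; case: b.
      by apply: eq_card => x; rewrite !inE xpair_eqE eqb_id andbC.
    rewrite -(cardsID B [set x | psi x == i]).
    have -> : [set x | psi x == i] :&: B = [set x in B | psi x == i].
      by apply/setP => x; rewrite !inE andbC.
    by rewrite addKn; apply: eq_card => x; rewrite !inE xpair_eqE eqbF_neg andbC.
  move=> /and3P[T0 I0 E0] /and3P[T1 I1 E1].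
  have [[i b]|u uP] := @perm_of_fibers n _ (fun x => (phi0 x, x \in A0))
     (fun x => (phi x, x \in A)).
    by rewrite !cfib.
  exists u^-1%g; rewrite /act invgK /=; congr (_, _).
    by apply/ffunP => x; rewrite ffunE; have [] := uP x.
  by apply/setP => x; rewrite inE; have [] := uP x.
Qed.

(** What survives the cancellation is one orbit for each [r]-set [K] of colors, and each orbit
    contributes [n!]. *)
Lemma sum_coloring_wedge r : (r <= n)%N ->
  \sum_s coloring_cfun s * wedge n r s = (n`! * 'C(p, r))%N%:R.
Proof.
move=> rn; under eq_bigr => s _.
  rewrite coloring_cfunE wedgeE // /num_colorings -sum1dep_card natr_sum big_distrlr /=.
  under eq_bigr => phi _ do under eq_bigr => A _ do rewrite mul1r.
  rewrite big_mkcondr /=.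
  under eq_bigr => phi _.
    rewrite (_ : (if _ then _ else _) = \sum_(A : {set 'I_n} | #|A| == r) (stabilizes phi s)%:R * set_sign A s); last first.
      by rewrite -mulr_sumr; case: stabilizes; rewrite ?mul1r ?mul0r.
    over.
  over.
rewrite exchange_big /=.
under eq_bigr => phi _.
  rewrite exchange_big /=.
  under eq_bigr => A _ do rewrite sum_set_sign_stabilizes.
  over.
rewrite pair_big_dep /= -natr_sum; congr _%:R.
rewrite (partition_big (fun X : coloring * {set 'I_n} => X.1 @: X.2) xpredT) //=.
transitivity (\sum_(K : {set 'I_p} | #|K| == r) n`!)%N; last first.
  by rewrite sum_nat_const mulnC -[in 'C(p, r)](card_ord p) -card_draws cardsE.
rewrite [RHS]big_mkcond /=; apply: eq_bigr => K _.
case: eqP => Kr.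
  rewrite -(sum_stab_coloring K) [LHS]big_mkcond [RHS]big_mkcond.
  apply: eq_bigr => -[phi A] _ /=; case: (has_type phi) => //=.
  case: (phi @: A =P K) => [phiK|]; rewrite ?andbF // !andbT.
  case: (#|phi @: A| =P #|A|) => [phiA|]; last by rewrite mul0n if_same.
  by rewrite mul1n -phiA phiK Kr eqxx.
rewrite big1 // => -[phi A] /= /andP[/andP[_ /eqP Ar] /eqP phiA].
by rewrite phiA Ar; case: eqP.
Qed.

(** Pascal's rule turns the alternating sum of the ['C(p, r)] into ['C(p - 1, r)]. *)
Lemma sum_coloring_hook r : (r < n)%N ->
  \sum_s coloring_cfun s * hook n r s = (n`! * 'C(p - 1, r))%N%:R.
Proof.
have p_gt0 : (0 < p)%N.
  rewrite lt0n; apply: contraTneq n_gt0 => /size0nil g0.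
  by move: g_comp; rewrite g0 /is_composition /= => /eqP <-.
elim: r => [|r IHr] rn /=; first by rewrite sum_coloring_wedge // !bin0.
under eq_bigr => s _ do rewrite coloring_cfunE !cfunE -coloring_cfunE mulrBr.
rewrite sumrB IHr 1?ltnW // sum_coloring_wedge 1?ltnW //.
rewrite -[p in 'C(p, _)](subnK p_gt0) addn1 binS mulnDr natrD.
by rewrite addrK.
Qed.
End Colorings.

(** * Convolution by class functions *)

Lemma cfun_irr_convolution (gT : finGroupType) (G : {group gT}) (f : 'CF(G)) (i : Iirr G) y :
  \sum_(x in G) f x * 'chi_i (x * y)%g =
  (\sum_(x in G) f x * 'chi_i x) / 'chi_i 1%g * 'chi_i y.
Proof.
(* Expanding the conjugate of [f] makes ['chi_j x^-1] appear, the form in which the generalized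
   orthogonality relation kills every term with [j] different from [i]. *)
have fE x : f x = \sum_j '['chi_j, f^*%CF] * 'chi_j x^-1%g.
  have -> : f x = (f^*%CF x)^* by rewrite cfunE conjCK.
  rewrite {1}(cfun_sum_cfdot f^*%CF) sum_cfunE rmorph_sum /=.
  by apply: eq_bigr => j _; rewrite cfunE rmorphM /= -cfdotC irr_inv.
have key z : \sum_(x in G) f x * 'chi_i (x * z)%g
   = #|G|%:R * '['chi_i, f^*%CF] * ('chi_i z / 'chi_i 1%g).
  under eq_bigr => x _ do rewrite fE mulr_suml.
  rewrite exchange_big /= (bigD1 i) //= [X in _ + X]big1 ?addr0.
    have := generalized_orthogonality_relation z i i.
    rewrite eqxx mul1r => <-.
    transitivity ('['chi_i, f^*%CF] * (\sum_(x in G) 'chi_i (x * z)%g * 'chi_i x^-1%g)).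
      by rewrite mulr_sumr; apply: eq_bigr => x _; ring.
    by field; rewrite neq0CG.
  move=> j ji; have := generalized_orthogonality_relation z i j.
  rewrite eq_sym (negPf ji) mul0r => /eqP; rewrite mulf_eq0 invr_eq0 (negPf (neq0CG _)) /=.
  move=> /eqP S0; transitivity ('['chi_j, f^*%CF] * (\sum_(x in G) 'chi_i (x * z)%g * 'chi_j x^-1%g)).
    by rewrite mulr_sumr; apply: eq_bigr => x _; ring.
  by rewrite S0 mulr0.
(* The case [z = 1] identifies the scalar. *)
rewrite key; have := key 1%g; under eq_bigr do rewrite mulg1.
by move=> ->; rewrite divff ?irr1_neq0 // mulr1; ring.
Qed.

Lemma sum_ffun_recl (R : nmodType) (T : finType) (k : nat) (F : {ffun 'I_k.+1 -> T} -> R) :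
  \sum_f F f = \sum_x \sum_(f : {ffun 'I_k -> T}) F [ffun i => if unlift ord0 i is Some j then f j else x].
Proof.
pose h (p : T * {ffun 'I_k -> T}) :=
  [ffun i => if unlift ord0 i is Some j then p.2 j else p.1] : {ffun 'I_k.+1 -> T}.
rewrite pair_big /= (reindex h) //=.
exists (fun f => (f ord0, [ffun j => f (lift ord0 j)])) => [[x f]|f] _ /=.
  congr (_, _); first by rewrite ffunE unlift_none.
  by apply/ffunP => j; rewrite !ffunE liftK.
by apply/ffunP => i; rewrite ffunE /=; case: unliftP => [j|] ->; rewrite ?ffunE.
Qed.

(** By induction on [k], the first factor is absorbed through [cfun_irr_convolution] and leaves its
    scalar; the empty composition leaves ['chi_i 1]. *)
Lemma sum_perm_comps (k n : nat) (f : 'I_k -> 'CF([set: 'S_n])) (i : Iirr [set: 'S_n]) :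
  \sum_(pi : {ffun 'I_k -> 'S_n}) (\prod_t f t (pi t)) * 'chi_i (perm_comps pi) =
  'chi_i 1%g * \prod_t ((\sum_s f t s * 'chi_i s) / 'chi_i 1%g).
Proof.
elim: k f => [|k IHk] f.
  rewrite (big_pred1 [ffun=> 1%g]) /=; last first.
    by move=> pi; apply/esym/eqP/ffunP => -[].
  by rewrite !big_ord0 mulrC /perm_comps big_ord0.
rewrite sum_ffun_recl exchange_big /= big_ord_recl.
rewrite mulrCA -IHk mulr_sumr; apply: eq_bigr => pi _.
under eq_bigr => s _.
  rewrite /perm_comps !big_ord_recl ffunE unlift_none.
  under eq_bigr => t _ do rewrite ffunE liftK.
  under [X in perm_comp _ X]eq_bigr => t _ do rewrite ffunE liftK.
  rewrite -/(perm_comps pi) /perm_comp mulrAC -[f _ _ * _ * _]mulrA mulrC.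
  over.
transitivity ((\prod_t f (lift ord0 t) (pi t)) *
  \sum_s f ord0 s * 'chi_i (s * perm_comps pi)%g).
  rewrite mulr_sumr; apply: eq_bigr => s _.
  (* [perm_comp] reverses products, so the first factor stands on the right; a character does not
     see the swap. *)
  have -> : 'chi_i (s * perm_comps pi)%g = 'chi_i (perm_comps pi * s)%g.
    by rewrite -[RHS](cfunJ 'chi_i _ (in_setT (perm_comps pi))) /conjg !mulgA mulVg mul1g.
  by ring.
have := cfun_irr_convolution (f ord0) i (perm_comps pi).
have sumT (F : 'S_n -> algC) : \sum_(s in [set: 'S_n]) F s = \sum_s F s.
  by apply: eq_bigl => s; rewrite inE.
by rewrite !sumT => ->; ring.
Qed.

(** * The number of factorizations as a sum over hooks *)

Section Counting.
Variables (k n : nat) (gamma : 'I_k -> seq nat).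
Hypotheses (n_gt0 : (0 < n)%N) (gammaP : forall t, is_composition n (gamma t)).

Lemma num_colored_factorizationsE :
  num_colored_factorizations n gamma =
  (\sum_(pi : {ffun 'I_k -> 'S_n} | perm_comps pi == long_cycle n)
     \prod_t num_colorings (gamma t) (pi t))%N.
Proof.
rewrite /num_colored_factorizations -sum1dep_card.
transitivity (\sum_(pi : {ffun 'I_k -> 'S_n} | perm_comps pi == long_cycle n)
  \sum_(phi : colorings k n (fun t => size (gamma t)) |
     phi \in family (fun t => [pred f | has_type f && stabilizes f (pi t)])) 1)%N.
  rewrite pair_big_dep /=; apply: eq_bigl => -[pi phi] /=.
  rewrite /colored_factorization -andbA; congr (_ && _).
  under [X in _ && X && _]eq_forallb => t do rewrite stabilizes_porbit.
  apply/andP/familyP => [[/andP[_ /forallP st] /andP[_ /forallP ty]] t|fam].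
    by rewrite inE st andbT; apply: ty.
  have {}fam t : has_type (phi t) && stabilizes (phi t) (pi t) by have := fam t.
  split; apply/andP; split; apply/forallP => t //; have /andP[ty st] // := fam t.
  (* Surjectivity comes from the positivity of the parts. *)
  apply/forallP => i; have /forallP/(_ i)/eqP ci := ty.
  have: (0 < #|[set a | phi t a == i]|)%N.
    by rewrite ci; case/andP: (gammaP t) => /all_nthP gP _; apply: gP.
  by case/card_gt0P => x; rewrite inE => xi; apply/existsP; exists x.
apply: eq_bigr => pi _; rewrite sum1_card card_family foldrE big_map big_enum /=.
by apply: eq_bigr => t _; rewrite /num_colorings cardsE.
Qed.

Lemma perm_compsJ (pi : {ffun 'I_k -> 'S_n}) (u : 'S_n) :
  perm_comps [ffun t => (pi t ^ u)%g] = (perm_comps pi ^ u)%g.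
Proof.
rewrite /perm_comps; under eq_bigr do rewrite ffunE.
by apply/esym; apply: (big_morph (fun s => s ^ u)%g) => [s v|];
  rewrite ?conj1g // /perm_comp conjMg.
Qed.

(** The weighted number [N s] of factorizations of [s] is a class function, so [sum_hook_altsum]
    isolates the long cycle and [sum_perm_comps] evaluates the pairing with each irreducible
    hook. *)
Lemma num_colored_factorizations_hook :
  (n`! * num_colored_factorizations n gamma)%N%:R =
  \sum_(r < n) (-1) ^+ r * ('C(n - 1, r)%:R *
    \prod_t ((n`! * 'C(size (gamma t) - 1, r))%N%:R / 'C(n - 1, r)%:R)) :> algC.
Proof.
pose N (s : 'S_n) : algC := \sum_(pi : {ffun 'I_k -> 'S_n} | perm_comps pi == s)
     \prod_t coloring_cfun n (gamma t) (pi t).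
have NJ s u : N (s ^ u)%g = N s.
  pose h (pi : {ffun 'I_k -> 'S_n}) := [ffun t => (pi t ^ u)%g].
  have h_inj : injective h.
    move=> pi pi' /ffunP e; apply/ffunP => t.
    by have := e t; rewrite !ffunE => /conjg_inj.
  rewrite /N (reindex_inj h_inj) /=; apply: eq_big => [pi|pi _].
    by rewrite perm_compsJ (inj_eq (conjg_inj u)).
  by apply: eq_bigr => t _; rewrite ffunE cfunJ ?in_setT.
have := sum_hook_altsum n_gt0 NJ.
have -> : N (long_cycle n) = (num_colored_factorizations n gamma)%:R.
  rewrite num_colored_factorizationsE natr_sum; apply: eq_bigr => pi _.
  by rewrite natr_prod; apply: eq_bigr => t _; rewrite coloring_cfunE.
rewrite -natrM => <-.
under eq_bigr => s _ do rewrite sum_cfunE mulr_sumr.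
rewrite exchange_big /=; apply: eq_bigr => r _.
have [i hi] := hook_irr n_gt0 (ltn_ord r).
(* Summing over [s] frees the tuple [pi] from the constraint on its composition. *)
transitivity ((-1) ^+ r * \sum_(pi : {ffun 'I_k -> 'S_n})
  (\prod_t coloring_cfun n (gamma t) (pi t)) * 'chi_i (perm_comps pi)).
  rewrite mulr_sumr [RHS](partition_big (fun pi : {ffun 'I_k -> 'S_n} => perm_comps pi) xpredT) //=.
  apply: eq_bigr => s _; rewrite cfunE hi mulr_suml; apply: eq_bigr => pi /eqP ->.
  by ring.
rewrite sum_perm_comps -hi hook1 //; congr (_ * (_ * _)).
by apply: eq_bigr => t _; rewrite sum_coloring_hook.
Qed.
End Counting.

(** * Coefficient extraction and the final formula *)

Lemma mcoeff_prod_univariate (R : comNzRingType) (k m : nat) (a : 'I_k -> nat -> R) (q : 'I_k -> nat) :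
    (forall i, q i < m)%N ->
  (\prod_(i < k) (\sum_(j < m) a i j *: 'X_i ^+ j : {mpoly R[k]}))@_[multinom q i | i < k]
  = \prod_(i < k) a i (q i).
Proof.
move=> qm; have monE (f : {ffun 'I_k -> 'I_m}) :
    \prod_(i < k) (a i (f i) *: 'X_i ^+ (f i) : {mpoly R[k]}) =
    (\prod_(i < k) a i (f i))%:MP * 'X_[[multinom (f i : nat) | i < k]].
  rewrite mul_mpolyC scaler_prod; congr (_ *: _); rewrite mpolyXE_id.
  by apply: eq_bigr => i _; rewrite mnmE.
have -> : \prod_(i < k) (\sum_(j < m) a i j *: 'X_i ^+ j : {mpoly R[k]}) =
    \sum_(f : {ffun 'I_k -> 'I_m}) (\prod_(i < k) a i (f i))%:MP * 'X_[[multinom (f i : nat) | i < k]].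
  by rewrite bigA_distr_bigA; under eq_bigr => f _ do rewrite monE.
(* Distinct exponent functions give distinct monomials, so only the one equal to [q] contributes. *)
rewrite raddf_sum (big_only1 [ffun i => Ordinal (qm i)]) //= => [|f fq _].
  rewrite mcoeffCM mcoeffX.
  rewrite (_ : _ == _); last by apply/eqP/mnmP => i; rewrite !mnmE ffunE.
  by rewrite mulr1; apply: eq_bigr => i _; rewrite ffunE.
rewrite mcoeffCM mcoeffX; case: eqP => [/mnmP e|]; rewrite ?mulr0 //.
case/eqP: fq; apply/ffunP => i; apply: val_inj.
by have := e i; rewrite !mnmE ffunE.
Qed.

(* The coefficient of x^q in x^r (1 + x)^(m - r). *)
Definition shifted_bin m r q : nat := if (r <= q)%N then 'C(m - r, q - r) else 0.

Lemma expr1DX_mulXn k m r (i : 'I_k) : (r <= m)%N ->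
  (1 + 'X_i) ^+ (m - r) * 'X_i ^+ r =
  \sum_(j < m.+1) (shifted_bin m r j)%:Z *: 'X_i ^+ j :> {mpoly int[k]}.
Proof.
move=> rm; pose F j : {mpoly int[k]} := (shifted_bin m r j)%:Z *: 'X_i ^+ j.
rewrite -(big_mkord xpredT F) (big_cat_nat (n := r)) //=; last exact: leqW.
rewrite big_nat_cond big1 ?add0r => [|j /andP[/andP[_ jr] _]]; last first.
  by rewrite /F /shifted_bin leqNgt jr scale0r.
rewrite -{3}[r]add0n big_addn subSn // big_mkord exprDn mulr_suml.
apply: eq_bigr => j _; rewrite /F /shifted_bin leq_addl addnK expr1n mul1r.
by rewrite exprD mulrnAl -scaler_nat natz.
Qed.

(** In the binomial expansion of the power, the term of index [r] is a product over [i] of the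
    univariate polynomials of [expr1DX_mulXn]. *)
Lemma McoefE (k m : nat) (q : 'I_k -> nat) : (forall i, q i <= m)%N ->
  Mcoef m q =
  \sum_(r < m.+1) (-1) ^+ r * ('C(m, r) * \prod_(i < k) shifted_bin m r (q i))%N%:Z.
Proof.
move=> qm; rewrite /Mcoef exprBn raddf_sum /=; apply: eq_bigr => r _.
have rm : (r <= m)%N by rewrite -ltnS.
rewrite mcoeffMn -mulrA -!prodrXl -big_split /=.
under eq_bigr => i _ do rewrite expr1DX_mulXn //.
rewrite -[(-1) ^+ r]signr_odd -[in RHS]signr_odd !mulr_sign.
rewrite PoszM (_ : Posz (\prod_(i < k) _) = \prod_(i < k) (shifted_bin m r (q i))%:Z).
  rewrite -(mcoeff_prod_univariate (m := m.+1) (fun _ j => (shifted_bin m r j)%:Z) qm).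
  by case: odd; rewrite ?mcoeffN ?mulNrn -mulr_natl natz.
by rewrite -natz natr_prod; apply: eq_bigr => i _; rewrite natz.
Qed.

(** Both sides count the [r]-sets inside [q]-sets of [m] points, choosing the larger or the smaller
    set first. *)
Lemma mul_bin_shifted m q r : (q <= m)%N ->
  ('C(q, r) * 'C(m, q) = 'C(m, r) * shifted_bin m r q)%N.
Proof.
move=> qm; rewrite /shifted_bin; case: leqP => [rq|qr]; last first.
  by rewrite bin_small // mul0n muln0.
have pos : (0 < r`! * (q - r)`! * (m - q)`! * q`! * (m - r)`!)%N.
  by rewrite !muln_gt0 !fact_gt0.
apply/eqP; rewrite -(eqn_pmul2r pos); apply/eqP.
have h1 := bin_fact rq; have h2 := bin_fact qm; have h3 := bin_fact (leq_trans rq qm).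
have h4 := @bin_fact (m - r) (q - r) (leq_sub2r r qm).
have e : (m - r - (q - r) = m - q)%N by lia.
rewrite e in h4.
transitivity (q`! * m`! * (m - r)`!)%N; first by rewrite -{2}h1 -h2; ring.
by rewrite -{1}h4 -h3; ring.
Qed.

Lemma composition_size (n : nat) (g : seq nat) :
  is_composition n g -> (size g <= n)%N.
Proof.
case/andP => + /eqP <-; elim: g => //= a g IHg /andP[a_gt0 /IHg].
by rewrite -add1n; apply: leq_add.
Qed.

Theorem corollary1p4 (k n : nat) (hk : (2 <= k)%N) (hn : (1 <= n)%N)
    (gamma : 'I_k -> seq nat)
    (hgamma : forall t : 'I_k, is_composition n (gamma t)) :
  ((num_colored_factorizations n gamma)%:R : rat)%R =
  (((n`!)%:R ^+ (k - 1)
      * (Mcoef (n - 1) (fun t : 'I_k => size (gamma t) - 1)%N)%:~R)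
    / \prod_(t < k) ('C(n - 1, size (gamma t) - 1))%:R)%R.
Proof.
case: n hn hgamma => // m hn hgamma; rewrite [(m.+1 - 1)%N]subn1 /=.
have [q qE] : {q : 'I_k -> nat | forall t, (size (gamma t) - 1)%N = q t}.
  by exists (fun t => (size (gamma t) - 1)%N).
have qm t : (q t <= m)%N by rewrite -qE leq_subLR add1n composition_size.
have bin_neq0 r : (r <= m)%N -> 'C(m, r)%:R != 0 :> algC.
  by move=> rm; rewrite pnatr_eq0 -lt0n bin_gt0.
have fact_neq0 : (m.+1)`!%:R != 0 :> algC by rewrite pnatr_eq0 -lt0n fact_gt0.
(* The identity is moved to [algC], where the characters take their values. *)
apply: (fmorph_inj (ratr : rat -> algC)).
rewrite fmorph_div rmorphM rmorphXn rmorph_prod /= !ratr_nat ratr_int.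
under [in RHS]eq_bigr => t _ do rewrite ratr_nat qE.
apply: (mulfI fact_neq0); rewrite -natrM num_colored_factorizations_hook // subn1 /=.
have -> : Mcoef m (fun t : 'I_k => size (gamma t) - 1)%N = Mcoef m q.
  by rewrite /Mcoef; congr (_@__); apply/mnmP => t; rewrite !mnmE qE.
rewrite !mulrA -exprS (_ : (k - 1).+1 = k); last by lia.
rewrite McoefE // rmorph_sum mulr_sumr mulr_suml; apply: eq_bigr => r _.
have rm : (r <= m)%N by rewrite -ltnS.
rewrite rmorphM rmorph_sign /= -[X in _ = _ * (_ * X) / _]/((_ : nat)%:Z%:~R) -pmulrn.
rewrite (natrM _ 'C(m, r)) natr_prod.
transitivity ((-1) ^+ r * ('C(m, r)%:R *
   \prod_(t < k) ((m.+1)`!%:R * (shifted_bin m r (q t))%:R / 'C(m, q t)%:R)) : algC).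
  congr (_ * (_ * _)); apply: eq_bigr => t _.
  (* This trades ['C(q t, r) / 'C(m, r)] for [shifted_bin m r (q t) / 'C(m, q t)], whose denominator
     is independent of [r]. *)
  have /(congr1 (fun x : nat => x%:R : algC)) := mul_bin_shifted r (qm t).
  rewrite qE (natrM _ (m.+1)`!) !(natrM _ 'C(_, _)) -!mulrA => e; congr (_ * _).
  by apply/eqP; rewrite eqr_div ?bin_neq0 // e mulrC.
rewrite big_split big_split /= prodr_const card_ord -prodfV.
by ring.
Qed.
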